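(* Let $\alpha=(a_1,\ldots,a_n)\in PP_n$ and let $k\ge 1$ be an integer. The following are equivalent: (i) for every maximal interval $[p,q]\subseteq U_\alpha$, $|[p,q]|\le k$ (where $|[p,q]|=q-p+1$); (ii) for all permutations $\sigma$ of $\{1,\ldots,n\}$, the $n$-tuple $\sigma(\alpha)=(a_{\sigma(1)},a_{\sigma(2)},\ldots,a_{\sigma(n)})$ is a $k$-Naples parking function of length $n$ (in particular, $\alpha\in PF_{n,k}$).
   Context: For integers $a\le b$, $[a,b]=\{a,\ldots,b\}$ and $[n]=[1,n]$. A parking preference of length $n$ is a tuple $\alpha=(a_1,\ldots,a_n)$ with entries in $[n]$; $PP_n$ is the set of these. Cars $c_1,\ldots,c_n$ arrive in this order at a one-way street with spots $1,\ldots,n$, and $a_i$ is the preferred spot of $c_i$. $k$-Naples parking rule: car $c_i$ parks in spot $a_i$ if it is free; otherwise it checks one at a time the spots $a_i-1,a_i-2,\ldots,a_i-k$ (only those that are $\ge 1$), parking in the first free one found; if none is free, it proceeds forward and parks in the first free spot $>a_i$, if any; otherwise it fails to park. $PF_{n,k}$, the set of $k$-Naples parking functions of length $n$, is the set of $\alpha\in PP_n$ for which all cars park under this rule. $|\alpha|_i$ is the number of indices $h$ with $a_h=i$. The excess function is $u_\alpha(j)=\sum_{i=j}^n|\alpha|_i-(n-j+1)$ for $j\in[n]$, and $U_\alpha=\{j\in[n] : u_\alpha(j)\ge 1\}$. A maximal interval $[p,q]\subseteq U_\alpha$ is a nonempty interval of consecutive integers contained in $U_\alpha$ that is maximal under inclusion.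 *)

(* Defs.v *)
From mathcomp Require Import all_boot all_order all_algebra all_fingroup.

Set Implicit Arguments.
Unset Strict Implicit.
Unset Printing Implicit Defensive.

Import GRing.Theory.

(* Spots and preferences are natural numbers numbered from 1, so that
   [n] = {1, ..., n}; the cars are indexed by 'I_n, i.e. from 0. *)
Definition parking_preference (n : nat) (alpha : n.-tuple nat) : bool :=
  all (fun a => 1 <= a <= n) alpha.

(* The spots a - 1, a - 2, ..., a - k in this order, keeping those >= 1:
   for naturals, 1 <= a - d amounts to d < a. *)
Definition backward_spots (k a : nat) : seq nat :=
  [seq a - d | d <- iota 1 k & d < a].

(* a + 1, a + 2, ..., n *)
Definition forward_spots (n a : nat) : seq nat := iota a.+1 (n - a).

(* The spots in the order in which the k-Naples rule checks them; the car
   takes the first one outside occ, and None means that it fails to park. *)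
Definition naples_spot (n k : nat) (occ : seq nat) (a : nat) : option nat :=
  ohead [seq x <- a :: backward_spots k a ++ forward_spots n a | x \notin occ].

Fixpoint all_cars_park (n k : nat) (occ : seq nat) (prefs : seq nat) : bool :=
  if prefs is a :: prefs' then
    if naples_spot n k occ a is Some x then all_cars_park n k (x :: occ) prefs'
    else false
  else true.

Definition naples_parking_function (n k : nat) (alpha : n.-tuple nat) : bool :=
  parking_preference alpha && all_cars_park n k [::] alpha.

Definition rearrange (n : nat) (s : 'S_n) (alpha : n.-tuple nat) :
    n.-tuple nat :=
  [tuple tnth alpha (s i) | i < n].

(* The values are integers: the excess may be negative. *)
Definition excess (n : nat) (alpha : n.-tuple nat) (j : nat) : int :=
  ((\sum_(j <= i < n.+1) count_mem i alpha)%N%:Z - (n%:Z - j%:Z + 1))%R.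

Definition excess_set (n : nat) (alpha : n.-tuple nat) : pred nat :=
  fun j => (1 <= j <= n) && (1 <= excess alpha j)%R.

Definition interval_in (U : pred nat) (p q : nat) : Prop :=
  p <= q /\ forall j : nat, p <= j <= q -> U j.

Definition maximal_interval (U : pred nat) (p q : nat) : Prop :=
  interval_in U p q /\
  forall p' q' : nat, interval_in U p' q' -> p' <= p -> q <= q' ->
    p' = p /\ q' = q.

(* Main.v *)
(** Both directions compare, for suitable j, the number of cars parked in
    [j, n] with the number of cars preferring a spot in [j, n].

    If some car fails to park, let e be the last free spot at that time.  No
    car can have jumped forward over e from a spot at most e + k, so for
    e < j <= e + k + 1 every car parked in [j, n] prefers a spot >= j; the spots
    of [j, n] are all taken and the failing car also prefers a spot >= j.
    Hence [e + 1, e + k + 1] lies in the excess set.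

    Conversely, let [p, q] be a maximal interval with q >= p + k, and let the
    cars with preference >= p come first, in increasing order.  A car with
    preference >= p + k cannot back up below p, and one with preference
    c < p + k need not: u(p) <= 1 (as p - 1 is not in the excess set) and
    u(c + 1) >= 1, so at most c - p + 1 cars prefer a spot in [p, c].  Hence
    these cars all fit in [p, n], contradicting u(p) >= 1. *)

Require Import Defs.
From mathcomp Require Import all_boot all_order all_algebra all_fingroup.
From mathcomp Require Import zify.

(** * The spot taken by one car *)

Lemma ohead_cat (T : Type) (s t : seq T) :
  ohead (s ++ t) = if ohead s is Some x then Some x else ohead t.
Proof. by case: s. Qed.

Lemma ohead_filter_None (T : eqType) (P : pred T) (s : seq T) :
  ohead [seq x <- s | P x] = None -> forall y, y \in s -> ~~ P y.
Proof.
move=> h y ys; apply/negP => Py.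
have: y \in [seq x <- s | P x] by rewrite mem_filter Py.
by case: [seq x <- s | P x] h.
Qed.

(** The spots checked form a decreasing run down from [a], then an increasing one; on each run this
    turns the first free spot into the greatest or least free one. *)
Lemma ohead_filter_sorted (T : eqType) (r : rel T) (P : pred T) (s : seq T) x :
    transitive r -> sorted r s -> ohead [seq x <- s | P x] = Some x ->
  [/\ P x, x \in s & forall y, y \in s -> P y -> y = x \/ r x y].
Proof.
move=> rtr /(sorted_filter rtr P).
have mf y := mem_filter P y s.
case E: [seq x <- s | P x] mf => [//|z t] mf /= /(order_path_min rtr) /allP zt [<-].
have /andP[Pz zs] : P z && (z \in s) by rewrite -mf mem_head.
split=> // y ys Py; move: (mf y); rewrite ys Py inE.
by case/orP=> [/eqP|/zt]; [left | right].
Qed.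

Lemma mem_backward k a y :
  (y \in backward_spots k a) = [&& 0 < y, y < a & a <= y + k].
Proof.
apply/mapP/and3P => [[d]|[h1 h2 h3]].
  by rewrite mem_filter mem_iota => /and3P[h1 h2 h3] ->; split; lia.
by exists (a - y); rewrite ?mem_filter ?mem_iota; lia.
Qed.

Lemma mem_forward n a y : (y \in forward_spots n a) = (a < y <= n).
Proof. by rewrite mem_iota; lia. Qed.

Lemma backward_sorted k a : sorted gtn (a :: backward_spots k a).
Proof.
rewrite /= path_min_sorted; last by apply/allP => y; rewrite mem_backward /=; lia.
rewrite sorted_map.
apply: (@sub_in_sorted _ [pred d | d < a] ltn).
- by move=> x y; rewrite !inE /=; lia.
- by apply/allP => x; rewrite mem_filter => /andP[].
- exact: (sorted_filter ltn_trans _ (iota_ltn_sorted 1 k)).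
Qed.

Lemma naples_spot_None n k occ a : naples_spot n k occ a = None ->
  forall y, 0 < y <= n -> a <= y + k -> y \in occ.
Proof.
move=> /ohead_filter_None h y hy hk; apply/negPn/h.
rewrite inE mem_cat mem_backward mem_forward.
by case: (ltngtP y a) => //; lia.
Qed.

Lemma naples_spot_Some n k occ a x : naples_spot n k occ a = Some x ->
  x \notin occ /\
  [\/ x = a,
      [/\ 0 < x, x < a <= x + k & forall y, x < y <= a -> y \in occ] |
      a < x <= n /\ forall y, 0 < y < x -> a <= y + k -> y \in occ].
Proof.
rewrite /naples_spot -cat_cons filter_cat ohead_cat.
case E: (ohead _) => [z|] h.
  case: h E => -> {z}.
  have gt_trans : transitive gtn by move=> ? ? ? /=; lia.
  case/(ohead_filter_sorted _ _ _ _ _ gt_trans (backward_sorted k a)) => xocc.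
  rewrite inE mem_backward => xa hx; split=> //.
  case/orP: xa => [/eqP|/and3P[x0 lxa axk]]; first by constructor 1.
  constructor 2; split=> [//||y hy]; first by rewrite lxa.
  apply/negPn/negP => yocc.
  have ym : y \in a :: backward_spots k a.
    by rewrite inE mem_backward; case: (ltngtP y a) => //=; lia.
  by case: (hx y ym yocc) => /=; lia.
have [xocc + hx] := ohead_filter_sorted _ _ _ _ _ ltn_trans (iota_ltn_sorted _ _) h.
rewrite mem_forward => xf; split=> //; constructor 3; split=> // y hy yk.
case: (leqP y a) => ya.
  apply/negPn/(ohead_filter_None _ _ _ E).
  by rewrite inE mem_backward; case: (ltngtP y a) ya => //=; lia.
apply/negPn/negP => yocc.
have ym : y \in forward_spots n a by rewrite mem_forward; lia.
by case: (hx y ym yocc); lia.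
Qed.

(** If [a < j <= x], the car moved forward past [e]. As [a <= e + k], it would have checked [e]
    before [x], on the way back or on the way forward, and parked there. *)
Lemma no_jump_over_free {n k occ a x e j} :
    naples_spot n k occ a = Some x ->
    0 < e -> e \notin x :: occ -> e < j <= e + k.+1 -> j <= x -> j <= a.
Proof.
move=> /naples_spot_Some[_ hx] e0; rewrite inE negb_or => /andP[xe eocc] hj jx.
case: leqP => // aj; case: hx => [|[]|[xa hocc]]; try lia.
by move/negP: eocc; case; apply: hocc; lia.
Qed.

(** * A failing car forces a long run of excess *)

Lemma count_leq_full (s : seq nat) j n :
  (forall y, j <= y <= n -> y \in s) -> n.+1 <= count (leq j) s + j.
Proof.
move=> h; rewrite addnC -leq_subLR -size_filter.
rewrite -[X in X <= _](size_iota j); apply: uniq_leq_size; first exact: iota_uniq.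
move=> y; rewrite mem_iota mem_filter => hy; apply/andP; split; first by lia.
by apply: h; lia.
Qed.

Lemma exists_last_free n (occ : seq nat) : size occ < n ->
  exists e, [/\ 0 < e <= n, e \notin occ
              & forall y, e < y <= n -> y \in occ].
Proof.
move=> sz; pose P e := (0 < e <= n) && (e \notin occ).
have exP : exists e, P e.
  have /allPn[e] : ~~ all [in occ] (iota 1 n).
    apply/negP => /allP sub.
    have := uniq_leq_size (iota_uniq 1 n) sub.
    by rewrite size_iota leqNgt sz.
  by rewrite mem_iota => he hocc; exists e; rewrite /P hocc andbT; lia.
have Pn e : P e -> e <= n by case/andP; lia.
case: (ex_maxnP exP Pn) => e /andP[he hocc] emax; exists e; split=> // y hy.
apply/negPn/negP => yocc.
have /emax : P y by rewrite /P yocc andbT; lia.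
by lia.
Qed.

(** Induction on the cars still to come; [done] lists the preferences of those parked in [occ]. The
    invariant covers every free [e], since the last free spot is known only at the failure. *)
Lemma fail_excess n k (prefs occ done : seq nat) :
    all (fun a => 0 < a <= n) prefs -> size occ = size done ->
    size (done ++ prefs) <= n ->
    (forall e j, 0 < e -> e \notin occ -> e < j <= e + k.+1 ->
       count (leq j) occ <= count (leq j) done) ->
    ~~ all_cars_park n k occ prefs ->
  exists2 e, e + k.+1 <= n & forall j, e < j <= e + k.+1 ->
    n.+1 < count (leq j) (done ++ prefs) + j.
Proof.
elim: prefs occ done => [//|a prefs IH] occ done /= /andP[an rn] szo sz inv.
case E: (naples_spot n k occ a) => [x|].
  rewrite -cat_rcons; apply: IH => //=; first by rewrite szo size_rcons.
    by rewrite cat_rcons.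
  move=> e j e0 exo hj; rewrite -cats1 count_cat /= addn0 addnC.
  apply: leq_add; last first.
    by case: (leqP j x) => // /(no_jump_over_free E e0 exo hj) ->.
  by apply: (inv e) => //; move: exo; rewrite inE negb_or => /andP[].
move=> _; have full := naples_spot_None _ _ _ _ E.
have [|e [en eocc last_e]] := exists_last_free n occ.
  by move: sz; rewrite size_cat szo /=; lia.
(* The failing car did not check [e], so it prefers a spot [>= j] for each [j <= e + k.+1]; it
   supplies the strict inequality. *)
have ea : e + k < a by rewrite ltnNge; apply: contra eocc; apply: full.
exists e; first by lia.
move=> j hj.
have := count_leq_full occ j n (fun y hy => last_e y ltac:(lia)).
have := inv e j ltac:(lia) eocc hj.
by rewrite count_cat /= (_ : j <= a) /=; lia.
Qed.

(** * Cars that stay in [[p, n]] *)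

Lemma all_cars_park_cat n k occ s t :
  all_cars_park n k occ (s ++ t) -> all_cars_park n k occ s.
Proof.
by elim: s occ => [//|a s IH] occ /=; case: naples_spot => // x; apply: IH.
Qed.

(** The last numeric hypothesis leaves room in [[p, c]] for all cars parked so far and all remaining
    ones preferring at most [c]. *)
Lemma park_above n k p (prefs occ : seq nat) :
    0 < p -> p <= n.+1 -> sorted leq prefs -> all (fun a => p <= a <= n) prefs ->
    uniq occ -> all (fun x => p <= x <= n) occ ->
    (forall c, c \in prefs -> c < p + k ->
       size occ + count (geq c) prefs + p <= c.+1) ->
    all_cars_park n k occ prefs ->
  size occ + size prefs + p <= n.+1.
Proof.
move=> p0 pn; elim: prefs occ => [|a prefs IH] occ.
  move=> _ _ uo /allP ho _ _; rewrite /= addn0.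
  suff: size occ <= size (iota p (n.+1 - p)).
    by rewrite size_iota -(leq_add2r p) subnK.
  by apply: uniq_leq_size => // x /ho; rewrite mem_iota; lia.
move=> srt /= /andP[an rn] uo ho inv.
case E: (naples_spot n k occ a) => [x|//].
have [xocc hx] := naples_spot_Some _ _ _ _ _ E.
have px : p <= x <= n.
  case: hx => [->//|[x0 xa hocc]|[xa _]]; last by lia.
  rewrite andbC; apply/andP; split; first by lia.
  case: leqP => // xp.
  have := inv a (mem_head _ _) ltac:(lia); rewrite leqnn => room.
  (* Backing up below [p] needs all [a - p + 1] spots of [[p, a]] taken, but [room] also counts the
     current car. *)
  have : size (iota p (a.+1 - p)) <= size occ.
    apply: uniq_leq_size; first exact: iota_uniq.
    by move=> y; rewrite mem_iota => hy; apply: hocc; lia.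
  by rewrite size_iota; lia.
move=> /(IH (x :: occ)) /=.
rewrite (path_sorted srt) rn xocc uo px ho addnS => -/(_ isT isT isT isT) h.
rewrite addSn in h; apply: h => c cp ck.
have := inv c; rewrite inE cp orbT => /(_ isT ck).
(* Since [a <= c], the car leaves the count as it enters [occ]: the bound is unchanged. *)
have /allP/(_ _ cp) /= -> := order_path_min leq_trans srt.
by lia.
Qed.

(** * Counting preferences, and the excess set *)

Lemma count_leqS (s : seq nat) c :
  count (geq c) s + count (leq c.+1) s = size s.
Proof.
rewrite -(count_predC (geq c) s); congr addn.
by apply: eq_count => x /=; rewrite ltnNge.
Qed.

Lemma count_leq_mono (s : seq nat) i j :
  i <= j -> count (leq j) s <= count (leq i) s.
Proof. by move=> ij; apply: sub_count => x; apply: leq_trans. Qed.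

Lemma sum_count_mem (s : seq nat) j n : all (geq n) s ->
  \sum_(j <= i < n.+1) count_mem i s = count (leq j) s.
Proof.
elim: s => [|a s IH] /=; first by rewrite big1.
move=> /andP[an sn]; rewrite big_split IH //=; congr addn.
have -> : \sum_(j <= i < n.+1) (a == i) = \sum_(j <= i < n.+1 | i == a) 1.
  by rewrite [RHS]big_mkcond; apply: eq_bigr => i _; rewrite eq_sym; case: eqP.
by rewrite big_nat1_eq ltnS an andbT; case: leqP.
Qed.

(** The condition [1 <= j] is absorbed: at [j = 0] the inequality fails, as the count is at most
    [n]. *)
Lemma excess_setE n (alpha : n.-tuple nat) j : parking_preference alpha ->
  excess_set alpha j = (j <= n) && (n.+1 < count (leq j) alpha + j).
Proof.
move=> /allP pref; rewrite /excess_set /excess sum_count_mem; last first.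
  by apply/allP => x /pref /andP[].
have := count_size (leq j) alpha; rewrite size_tuple.
by lia.
Qed.

Lemma maximal_interval_exists (U : pred nat) n p q :
    (forall j, U j -> j <= n) -> interval_in U p q ->
  exists p' q', [/\ maximal_interval U p' q', p' <= p & q <= q'].
Proof.
move=> Un [pq hU].
pose P i := (i <= p) && all U (index_iota i p.+1).
pose Q i := (q <= i) && all U (index_iota q i.+1).
have exP : exists i, P i.
  by exists p; rewrite /P leqnn /index_iota subSnn /= hU // leqnn.
have exQ : exists i, Q i.
  by exists q; rewrite /Q leqnn /index_iota subSnn /= hU // pq leqnn.
have Qn i : Q i -> i <= n.
  by case/andP=> qi /allP h; apply/Un/h; rewrite mem_index_iota; lia.
case: (ex_minnP exP) => p' /andP[pp' /allP hp] pmin.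
case: (ex_maxnP exQ Qn) => q' /andP[qq' /allP hq] qmax.
exists p', q'; split=> //; split.
  split=> [|j hj]; first by lia.
  case: (leqP j p) => jp; first by apply: hp; rewrite mem_index_iota; lia.
  case: (leqP j q) => jq; first by apply: hU; lia.
  by apply: hq; rewrite mem_index_iota; lia.
move=> p2 q2 [pq2 h2] hp2 hq2.
have /pmin : P p2.
  apply/andP; split; first by lia.
  by apply/allP => j; rewrite mem_index_iota => ?; apply: h2; lia.
have /qmax : Q q2.
  apply/andP; split; first by lia.
  by apply/allP => j; rewrite mem_index_iota => ?; apply: h2; lia.
by lia.
Qed.

Lemma rearrange_perm n (s : 'S_n) (alpha : n.-tuple nat) :
  perm_eq (rearrange s alpha) alpha.
Proof. by apply/tuple_permP; exists s. Qed.

Theorem corollary4p2 (n k : nat) (alpha : n.-tuple nat)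
    (Halpha : parking_preference alpha) (Hk : 1 <= k) :
  (forall p q : nat,
     maximal_interval (excess_set alpha) p q -> q - p + 1 <= k)
  <->
  (forall s : 'S_n, naples_parking_function k (rearrange s alpha)).
Proof.
have UE j := excess_setE _ _ j Halpha.
split=> [short s | park p q [[pq inU] pqmax]].
  have ps := rearrange_perm _ s alpha.
  have prefs : parking_preference (rearrange s alpha).
    by rewrite /parking_preference (perm_all _ ps).
  rewrite /naples_parking_function prefs; apply/negPn/negP.
  case/(fail_excess n k _ [::] [::] prefs) => //.
    by rewrite /= size_tuple card_ord.
  move=> e en over.
  (* The [k + 1] excess spots lie in a maximal interval, which is then too long. *)
  have [||p [q [pqmax pe eq]]] :=
      maximal_interval_exists (excess_set alpha) n e.+1 (e + k.+1).
  - by move=> j; rewrite UE => /andP[].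
  - split=> [|j hj]; first by lia.
    rewrite UE -(seq.permP ps); apply/andP; split; first by lia.
    exact: over.
  by have := short p q pqmax; lia.
rewrite leqNgt; apply/negP => long.
have := inU p; rewrite UE leqnn pq => /(_ isT) /andP[pn overp].
have p0 : 0 < p.
  by have := count_size (leq p) alpha; rewrite size_tuple; lia.
(* Otherwise u(p) >= 2, so u(p - 1) >= 1 and [[p - 1, q]] contradicts maximality. *)
have underp : count (leq p) alpha + p <= n.+2.
  rewrite leqNgt; apply/negP => h.
  have Up : excess_set alpha p.-1.
    rewrite UE; apply/andP; split; first by lia.
    by have := count_leq_mono alpha p.-1 p ltac:(lia); lia.
  have [|||] := pqmax p.-1 q; try lia.
  split=> [|j hj]; first by lia.
  by case: (leqP p j) => pj; [apply: inU; lia | have -> : j = p.-1 by lia].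
(* The cars of [r] arrive last, so only the parking of [t] matters. *)
pose t := sort leq [seq a <- alpha | p <= a].
pose r := [seq a <- alpha | ~~ (p <= a)].
have perm_t : perm_eq t [seq a <- alpha | p <= a] by rewrite perm_sort.
have perm_tr : perm_eq (t ++ r) alpha.
  by rewrite -(seq.permPr (permEl (perm_filterC (leq p) alpha))) perm_cat2r.
have sz : size (t ++ r) == n by rewrite (perm_size perm_tr) size_tuple.
have /tuple_permP[s st] : perm_eq (Tuple sz) alpha by [].
have /andP[_] := park s.
rewrite [tval _](_ : _ = t ++ r) // => /all_cars_park_cat.
have size_t : size t = count (leq p) alpha.
  by rewrite (perm_size perm_t) size_filter.
have t_pn : all (fun a => p <= a <= n) t.
  rewrite (perm_all _ perm_t); apply/allP => x; rewrite mem_filter => /andP[-> xa].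
  by move/allP/(_ _ xa)/andP: Halpha => [].
move/(park_above n k p t [::] p0) => -/(_ _ _ t_pn) /=.
rewrite add0n size_t => h.
suff : count (leq p) alpha + p <= n.+1 by lia.
apply: h => //; first by lia.
  by apply: sort_sorted; apply: leq_total.
(* By [long], [c + 1 <= p + k <= q], so [inU] applies at [c + 1]; subtracting from [underp] bounds
   the count. *)
move=> c ct ck; rewrite add0n.
have := count_leqS t c; rewrite size_t.
have -> : count (leq c.+1) t = count (leq c.+1) alpha.
  rewrite (seq.permP perm_t) count_filter; apply: eq_in_count => x _ /=.
  by move/allP/(_ _ ct): t_pn; lia.
have := inU c.+1; rewrite UE.
move/allP/(_ _ ct): t_pn.
by lia.
Qed.
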